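(* Let $G^{\nu}$ be a wconnected $\nu$-wgraph with $0\le\nu\le\omega$ (possibly $\nu=\vec{\omega}$), and let $\alpha<\rho\le\nu$ be ranks. Let $S^{\rho}$ be a $\rho$-wsection of $G^{\nu}$ and let $S^{\alpha}$ be an $\alpha$-wsection lying in $S^{\rho}$. Then the enlargement ${}^{*}S^{\alpha}$ of $S^{\alpha}$ lies within the principal $\rho$-galaxy $\Gamma_{0}^{\rho}(S^{\rho})$ of ${}^{*}S^{\rho}$; that is, every hypernode in ${}^{*}S^{\alpha}$ is a hypernode in $\Gamma_{0}^{\rho}(S^{\rho})$, and consequently every hyperbranch in ${}^{*}S^{\alpha}$ is a hyperbranch in $\Gamma_{0}^{\rho}(S^{\rho})$.
   Context: Ranks and ordinals. Ranks are the natural numbers $0,1,2,\dots$, the formal rank $\vec{\omega}$ (larger than all natural numbers and smaller than $\omega$), and $\omega$. For a rank $\rho=\omega$, ''$\rho-1$'' means $\vec{\omega}$. Ordinals are in Cantor normal form and are added by natural (Hessenberg) summation. $\mathcal{F}$ is a fixed free ultrafilter on $\mathbb{N}$. Wgraphs. A $0$-graph is $\{X^{0},B\}$, with $X^{0}$ a set of $0$-nodes and $B$ a set of branches, i.e. two-element subsets of $X^0$. A $0$-walk is an alternating sequence $\langle\dots,x_m,b_m,x_{m+1},\dots\rangle$ of $0$-nodes and branches, indexed by consecutive integers, with $b_m$ incident to $x_m$ and $x_{m+1}$, ending at a $0$-node wherever it terminates; repetitions are allowed. It is two-ended (finite), one-ended (one-way infinite) or endless (two-way infinite). A $(-1)$-tip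 is an end of a branch; a $0$-node embraces itself and the $(-1)$-tips of its incident branches. Recursively, for a natural number $\rho$, a $\rho$-wtip is an equivalence class of one-ended $\rho$-walks, two being equivalent if they are identical from some point on, up to a shift of indices. Partition the set of all $\rho$-wtips into nonempty subsets $T_i$; a $(\rho+1)$-wnode is a set $T_i\cup N_i$, where $N_i$ is empty or a singleton whose member (the exceptional element) is a wnode of rank at most $\rho$, and each wnode is the exceptional element of at most one wnode of higher rank. A wnode embraces itself, its elements, and everything embraced by its exceptional element. For $\rho\ge1$, a $\rho$-walk is an alternating sequence $\langle\dots,x_m,W_m,x_{m+1},W_{m+1},\dots\rangle$ indexed by consecutive integers, where the nonterminal $x_m$ are $\rho$-wnodes, a terminal element (wherever the sequence terminates) is a wnode of rank at most $\rho$, and each $W_m$ is a nontrivial walk of rank at most $\rho-1$ that reaches $x_m$ on its left and $x_{m+1}$ on its right (i.e. on that side it either terminates at a wnode embraced by that wnode or is infinite with its wtip embraced by that wnode), such that for each nonterminal $x_m$ at least one of $W_{m-1},W_m$ reaches $x_m$ through a $(\rho-1)$-wtip. Two-ended, one-ended and endless are as for $0$-walks. An $\vec{\omega}$-wnode is a maximal infinite chain of wnodes of strictly increasing natural-number ranks, each the exceptional element of the next; it embraces everything its members embrace. A one-ended $\vec{\omega}$-walk is a sequence $\langle x_0,W_0,x_1,W_1,\dots\rangle$ with $x_m$ a wnode of natural-number rank $\mu_m$, $\mu_0<\mu_1<\cdots$, and $W_m$ a walk of rank less than $\mu_{m+1}$ reaching $x_m$ and $x_{m+1}$, the latter through a $(\mu_{m+1}-1)$-wtip;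 an endless one joins two of these at their starting wnodes; $\vec{\omega}$-wtips are classes of eventually identical one-ended $\vec{\omega}$-walks (up to merging consecutive pieces). Partition the set of all $\vec{\omega}$-wtips into nonempty subsets $T_i$; an $\omega$-wnode is a set $T_i\cup N_i$, where $N_i$ is empty or a singleton whose member (the exceptional element) is a wnode of rank at most $\vec{\omega}$, and each wnode is the exceptional element of at most one wnode of higher rank; an $\omega$-wnode embraces itself, its elements, and everything embraced by its exceptional element. An $\omega$-walk is an alternating sequence $\langle\dots,x_m,W_m,x_{m+1},W_{m+1},\dots\rangle$ indexed by consecutive integers, where the nonterminal $x_m$ are $\omega$-wnodes, a terminal element (wherever the sequence terminates) is a wnode of rank at most $\omega$, and each $W_m$ is a nontrivial walk of rank at most $\vec{\omega}$ that reaches $x_m$ on its left and $x_{m+1}$ on its right, such that for each nonterminal $x_m$ at least one of $W_{m-1},W_m$ reaches $x_m$ through an $\vec{\omega}$-wtip; it is two-ended, one-ended or endless according to whether the sequence is finite, one-way infinite or two-way infinite. A $\nu$-wgraph is $G^{\nu}=\{X^{0},B,X^{1},\dots,X^{\nu}\}$, with $X^{\gamma}$ the set of $\gamma$-wnodes, nonempty except possibly for $\gamma=\vec{\omega}$. It is wconnected if every two wnodes are the terminal wnodes of some two-ended walk in it. Lengths and wdistance. The length $|W|$ of a two-ended $0$-walk is its number of branch traversals. For a natural number or $\omega$ as rank $\gamma$, a one-ended $\gamma$-walk has length $\omega^{\gamma+1}$ and an endless one $\omega^{\gamma+1}\cdot2$; a one-ended (endless) $\vec{\omega}$-walk has length $\omega^{\omega}$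 ($\omega^{\omega}\cdot 2$). A two-ended $\gamma$-walk with $\gamma\ge1$ has length the natural sum of the lengths of its constituent walks $W_m$. A wnode is maximal if it is not embraced by a wnode of higher rank. The wdistance is $d(x,y)=\min|W|$ over two-ended walks $W$ terminating at $x$ and $y$, where a walk terminating at a wnode is also regarded as terminating at any wnode embracing it and wdistances from a nonmaximal wnode equal those from the maximal wnode embracing it; $d(x,y)=0$ if $x,y$ are embraced by the same maximal wnode. Wsections. A $\rho$-wsection $S^{\rho}$ of $G^{\nu}$ ($\rho<\nu$) is a maximal wsubgraph of the $\rho$-wgraph $\{X^{0},B,\dots,X^{\rho}\}$ that is $\rho$-wconnected: every two of its wnodes are joined by a two-ended $\alpha$-walk with $\alpha\le\rho$ ($\alpha<\vec{\omega}$ if $\rho=\vec{\omega}$). It consists of a set of branches together with the wnodes of rank at most $\rho$ embracing a tip having a representative in those branches. The only $\nu$-wsection is $G^{\nu}$ itself. A wsection is a wgraph by itself, with its own wdistance $d$. For $\alpha<\rho$, the branch sets of the $\alpha$-wsections lying in $S^\rho$ partition the branch set of $S^{\rho}$. Enlargement. For a wsection $S$ of rank $\sigma$, a $\gamma$-hypernode of ${}^{*}S$ is an equivalence class $\mathbf{x}=[x_n]$ of sequences of $\gamma$-wnodes of $S$, two sequences being equivalent if they agree on a set of indices in $\mathcal{F}$. A hyperbranch is a pair $\{[x_n],[y_n]\}$ of $0$-hypernodes with $\{n:\{x_n,y_n\}\text{ is a branch of }S\}\in\mathcal{F}$. The enlargement ${}^{*}S$ consists of all hypernodes of all ranks at most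 $\sigma$ and all hyperbranches. A hypernode is standard if it is represented by a constant sequence. Galaxies. For $\rho$ a natural number or $\omega$, hypernodes $\mathbf{x}=[x_n]$ and $\mathbf{y}=[y_n]$ (of any ranks) of ${}^{*}S^{\rho}$ are $\rho$-limitedly distant if there is $\mu\in\mathbb{N}$ with $\{n: d(x_n,y_n)\le\omega^{\rho}\cdot\mu\}\in\mathcal{F}$; they are $\vec{\omega}$-limitedly distant if there is $\mu\in\mathbb{N}$ with $\{n:d(x_n,y_n)\le\omega^{\mu}\}\in\mathcal{F}$ (here $d$ is the wdistance in $S^\rho$). This is an equivalence relation on hypernodes; its classes are the nodal $\rho$-galaxies, and a $\rho$-galaxy consists of the hypernodes of a nodal $\rho$-galaxy together with the hyperbranches whose $0$-hypernodes lie in it. The principal $\rho$-galaxy $\Gamma_0^{\rho}(S^{\rho})$ of ${}^{*}S^{\rho}$ is the one whose hypernodes are $\rho$-limitedly distant from a standard hypernode. *)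

(* Defs.v *)
From mathcomp Require Import all_boot all_order all_algebra.
From mathcomp Require Import classical_sets filter.
From Stdlib Require Import Relation_Operators.

Set Implicit Arguments.
Unset Strict Implicit.
Unset Printing Implicit Defensive.
Import Order.TTheory GRing.Theory Num.Theory.

Local Open Scope classical_set_scope.
Local Open Scope ring_scope.

(** * Ranks *)

(* [Vomega] is the formal rank "omega with an arrow", which lies above all
   natural numbers and below omega; it is the predecessor of [Omega]. *)
Inductive rank := Fin of nat | Vomega | Omega.

Definition rle (r s : rank) : bool :=
  match r, s with
  | Fin m, Fin n => (m <= n)%N
  | Fin _, _ => true
  | _, Fin _ => false
  | Omega, Vomega => false
  | _, _ => true
  end.

Definition rlt (r s : rank) : bool := ~~ rle s r.

(* Ranks 0 and [Vomega] have no predecessor: their wnodes are not built from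
   wtips of an immediately lower rank. *)
Definition rprev (r : rank) : option rank :=
  match r with
  | Fin 0 => None
  | Fin n.+1 => Some (Fin n)
  | Vomega => None
  | Omega => Some Vomega
  end.

(** * Ordinals in Cantor normal form *)

(* [OCons e n r] is omega^e * (n + 1) + r; it is in normal form when the
   leading exponent of r is below e. *)
Inductive ord := OZero | OCons of ord & nat & ord.

Fixpoint ocmp (a b : ord) : comparison :=
  match a, b with
  | OZero, OZero => Eq
  | OZero, _ => Lt
  | _, OZero => Gt
  | OCons e n r, OCons e' n' r' =>
      match ocmp e e' with
      | Eq => if (n < n')%N then Lt else if (n' < n)%N then Gt else ocmp r r'
      | c => c
      end
  end.

Definition ole (a b : ord) : Prop := ocmp a b <> Gt.

(* Natural (Hessenberg) sum. *)
Fixpoint oplus (a b : ord) : ord :=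
  let fix oplus_a (b : ord) : ord :=
    match a, b with
    | OZero, _ => b
    | _, OZero => a
    | OCons e n r, OCons e' n' r' =>
        match ocmp e e' with
        | Gt => OCons e n (oplus r b)
        | Lt => OCons e' n' (oplus_a r')
        | Eq => OCons e (n + n').+1 (oplus r r')
        end
    end in
  oplus_a b.

Definition onat (n : nat) : ord := if n is m.+1 then OCons OZero m OZero else OZero.

(* omega^e * n *)
Definition opow (e : ord) (n : nat) : ord := if n is m.+1 then OCons e m OZero else OZero.

Definition omega : ord := opow (onat 1) 1.

Definition oleast (A : set ord) (d : ord) : Prop := A d /\ forall a, A a -> ole d a.

(** * Walks *)

Section Walks.
Variable V : Type.

(* A walk of rank r is an alternating sequence of wnodes [x m] and pieces [P m],
   the piece [P m] lying between [x m] and [x (m + 1)].  The wnodes are indexed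
   by the integers between the optional bounds [lo] and [hi]; an absent bound
   means that the walk is infinite on that side, and values outside of the
   bounds are meaningless.  The pieces of a 0-walk are branches.  These are raw
   sequences; the conditions making them walks are in [is_walk]. *)
Inductive walk : Type :=
| Branch of set V
| Walk of rank & option int & option int & (int -> V) & (int -> walk).

Definition in_range (lo hi : option int) (m : int) : bool :=
  (if lo is Some a then a <= m else true) && (if hi is Some b then m <= b else true).

Definition in_pieces (lo hi : option int) (m : int) : bool :=
  in_range lo hi m && in_range lo hi (m + 1).

Definition terminal (lo hi : option int) (m : int) : Prop :=
  lo = Some m \/ hi = Some m.

Definition has_rank (W : walk) (r : rank) : Prop :=
  if W is Walk s _ _ _ _ then s = r else False.

Definition rank_le (W : walk) (r : rank) : Prop :=
  if W is Walk s _ _ _ _ then rle s r else False.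

Definition nontrivial (W : walk) : Prop :=
  match W with
  | Walk _ (Some a) (Some b) _ _ => a < b
  | Walk _ _ _ _ _ => True
  | Branch _ => False
  end.

Definition right_infinite (W : walk) : Prop :=
  if W is Walk _ _ None _ _ then True else False.

Definition one_ended (W : walk) : Prop :=
  if W is Walk _ (Some _) None _ _ then True else False.

(* Two-ended, with terminal wnodes u on the left and v on the right. *)
Definition two_ended (W : walk) (u v : V) : Prop :=
  if W is Walk _ (Some a) (Some b) x _ then u = x a /\ v = x b else False.

Fixpoint rev_walk (W : walk) : walk :=
  match W with
  | Branch b => Branch b
  | Walk r lo hi x P =>
      Walk r (omap -%R hi) (omap -%R lo) (fun m => x (- m))
        (fun m => rev_walk (P (- m - 1)))
  end.

(* Equality of walks up to shifts of indices. *)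
Fixpoint same_walk (W W' : walk) : Prop :=
  match W, W' with
  | Branch b, Branch b' => b = b'
  | Walk r lo hi x P, Walk r' lo' hi' x' P' =>
      r = r' /\ exists s : int,
        [/\ lo' = omap (fun a => a + s) lo, hi' = omap (fun b => b + s) hi,
            forall m, in_range lo hi m -> x m = x' (m + s) &
            forall m, in_pieces lo hi m -> same_walk (P m) (P' (m + s))]
  | _, _ => False
  end.

(* Two walks, infinite on the right, that are identical from some point on up to
   a shift of indices. *)
Definition tail_eq (W W' : walk) : Prop :=
  match W, W' with
  | Walk r _ None x P, Walk r' _ None x' P' =>
      r = r' /\ exists N s : int, forall m, N <= m ->
        x m = x' (m + s) /\ same_walk (P m) (P' (m + s))
  | _, _ => False
  end.

(* The path p of indices leads, through successive pieces of W, to a branch that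
   W traverses from the 0-node u to the 0-node v.  Lexicographic order on paths
   is the order of traversal. *)
Fixpoint traverses (W : walk) (p : seq int) (u v : V) : Prop :=
  match W, p with
  | Walk _ lo hi x P, m :: q =>
      in_pieces lo hi m /\
      match P m with
      | Branch _ => [/\ q = [::], u = x m & v = x (m + 1)]
      | Walk _ _ _ _ _ => traverses (P m) q u v
      end
  | _, _ => False
  end.

(* W and W' perform the same branch traversals in the same order, however these
   are grouped into pieces. *)
Definition same_trace (W W' : walk) : Prop :=
  exists f : seq int -> seq int,
    [/\ forall p u v, traverses W p u v -> traverses W' (f p) u v,
        forall q u v, traverses W' q u v -> exists2 p, traverses W p u v & f p = q &
        forall p q u v u' v', traverses W p u v -> traverses W q u' v' ->
          ((p : seqlexi int) < (q : seqlexi int))%O ->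
          ((f p : seqlexi int) < (f q : seqlexi int))%O].

(* Two walks, infinite on the right, that become identical from some point on
   once consecutive pieces of each are merged: infinitely many wnodes, of
   increasing indices, are kept in each, and between two that follow each other
   the merged pieces are the same. *)
Definition merge_eq (W W' : walk) : Prop :=
  match W, W' with
  | Walk r lo None x P, Walk r' lo' None x' P' =>
      r = r' /\ exists f f' : nat -> int, forall k : nat,
        [/\ in_range lo None (f k) /\ in_range lo' None (f' k),
            f k < f k.+1 /\ f' k < f' k.+1,
            x (f k) = x' (f' k) &
            same_trace (Walk r (Some (f k)) (Some (f k.+1)) x P)
                       (Walk r' (Some (f' k)) (Some (f' k.+1)) x' P')]
  | _, _ => False
  end.

Definition tail_agree (r : rank) (W W' : walk) : Prop :=
  if r is Vomega then merge_eq W W' else tail_eq W W'.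

(* All branches traversed by W lie in C and all its wnodes lie in N. *)
Fixpoint walk_over (C : set (set V)) (N : set V) (W : walk) : Prop :=
  match W with
  | Branch b => C b
  | Walk _ lo hi x P =>
      (forall m, in_range lo hi m -> N (x m)) /\
      (forall m, in_pieces lo hi m -> walk_over C N (P m))
  end.

(* The exponent of omega in the length of a one-ended walk of rank r. *)
Definition tip_exponent (r : rank) : ord :=
  match r with
  | Fin n => onat n.+1
  | Vomega => omega
  | Omega => oplus omega (onat 1)
  end.

Fixpoint length (W : walk) : ord :=
  match W with
  | Branch _ => onat 1
  | Walk r lo hi x P =>
      match lo, hi with
      | Some a, Some b =>
          foldr (fun (i : nat) l => oplus (length (P (a + i%:Z))) l) OZero
            (iota 0 `|b - a|%N)
      | None, None => opow (tip_exponent r) 2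
      | _, _ => opow (tip_exponent r) 1
      end
  end.

End Walks.

(** * Wgraphs *)

(* The wnodes of all ranks of a wgraph, its branches, the wtips that are elements
   of each wnode, the exceptional element of each wnode, and, for a wnode of rank
   [Vomega], the chain that it is (from the lowest rank up). *)
Record wdata := WData {
  wnode : Type;
  wrank : wnode -> rank;
  branches : set (set wnode);
  wtips_of : wnode -> set (set (walk wnode));
  exceptional : wnode -> option wnode;
  chain_of : wnode -> nat -> wnode
}.

Section Data.
Variable D : wdata.
Local Notation V := (wnode D).
Implicit Types (x u v : V) (W : walk V).

(* [embraces x u]: the wnode x embraces the wnode u. *)
Inductive embraces : V -> V -> Prop :=
| embraces_refl x : embraces x x
| embraces_exceptional x y u :
    exceptional x = Some y -> embraces y u -> embraces x u
| embraces_chain x i u :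
    wrank x = Vomega -> embraces (chain_of x i) u -> embraces x u.

Definition embraces_wtip x (T : set (walk V)) : Prop :=
  exists2 u, embraces x u & wtips_of u T.

(* On its right, W terminates at a wnode embraced by x or is infinite with its
   wtip embraced by x.  The wtip of W there is identified by any of its
   representatives. *)
Definition reaches_right W x : Prop :=
  match W with
  | Walk r _ (Some b) y _ => embraces x (y b)
  | Walk r _ None _ _ =>
      exists T w, [/\ embraces_wtip x T, T w & tail_agree r W w]
  | Branch _ => False
  end.

Definition reaches_left W x : Prop := reaches_right (rev_walk W) x.

(* W reaches x on the right through a wtip of rank q. *)
Definition reaches_right_by_tip W q x : Prop :=
  [/\ has_rank W q, right_infinite W & reaches_right W x].

Definition reaches_left_by_tip W q x : Prop := reaches_right_by_tip (rev_walk W) q x.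

(* The piece W leads from x to y away from the start of a one-ended
   [Vomega]-walk. *)
Definition vomega_step x W y : Prop :=
  exists m n : nat,
    [/\ wrank x = Fin m /\ wrank y = Fin n.+1, (m < n.+1)%N,
        nontrivial W /\ rank_le W (Fin n), reaches_left W x &
        reaches_right_by_tip W (Fin n) y].

Fixpoint is_walk (W : walk V) : Prop :=
  match W with
  | Branch _ => False
  | Walk r lo hi x P =>
      (if lo is Some a then if hi is Some b then a <= b else true else true) /\
      match r, rprev r with
      | Vomega, _ =>
          (* The two halves of an endless [Vomega]-walk start at [x j]; a half is
             absent when [j] is a bound. *)
          (lo = None \/ hi = None) /\
          exists j,
            [/\ lo = None \/ lo = Some j,
                hi = None \/ hi = Some j &
                forall m, in_pieces lo hi m ->
                  is_walk (P m) /\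
                  if j <= m then vomega_step (x m) (P m) (x (m + 1))
                  else vomega_step (x (m + 1)) (rev_walk (P m)) (x m)]
      | _, None =>
          (forall m, in_range lo hi m -> wrank (x m) = Fin 0) /\
          (forall m, in_pieces lo hi m ->
             exists b, [/\ P m = Branch b, branches b & b = [set x m; x (m + 1)]])
      | _, Some q =>
          [/\ forall m, in_range lo hi m -> terminal lo hi m -> rle (wrank (x m)) r,
              forall m, in_range lo hi m -> ~ terminal lo hi m -> wrank (x m) = r,
              forall m, in_pieces lo hi m ->
                [/\ is_walk (P m), nontrivial (P m), rank_le (P m) q,
                    reaches_left (P m) (x m) & reaches_right (P m) (x (m + 1))] &
              forall m, in_range lo hi m -> ~ terminal lo hi m ->
                reaches_right_by_tip (P (m - 1)) q (x m) \/
                reaches_left_by_tip (P m) q (x m)]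
      end
  end.

Definition one_ended_walk (r : rank) W : Prop :=
  [/\ is_walk W, has_rank W r & one_ended W].

(* For r other than [Vomega], [tail_agree r] is already an equivalence
   relation. *)
Definition tip_equiv (r : rank) : walk V -> walk V -> Prop :=
  clos_trans (walk V)
    (fun W W' => [/\ one_ended_walk r W, one_ended_walk r W' & tail_agree r W W']).

Definition wtips (r : rank) : set (set (walk V)) :=
  [set T | exists2 W, one_ended_walk r W & T = [set W' | tip_equiv r W W']].

(* An infinite chain of wnodes of natural-number ranks, each the exceptional
   element of the next, that cannot be extended downward. *)
Definition maximal_chain (c : nat -> V) : Prop :=
  [/\ forall i, exists n, wrank (c i) = Fin n,
      forall i, exceptional (c i.+1) = Some (c i) &
      exceptional (c 0%N) = None].

End Data.

Record wgraph := WGraph {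
  wg_data :> wdata;
  nu : rank;
  wrank_le : forall x : wnode wg_data, rle (wrank x) nu;
  wnode_nonempty : forall r, rle r nu -> r <> Vomega ->
    exists x : wnode wg_data, wrank x = r;
  branchP : forall b : set (wnode wg_data), branches b ->
    exists x y, [/\ x <> y, wrank x = Fin 0, wrank y = Fin 0 & b = [set x; y]];
  wtips_partition : forall r q, rle r nu -> rprev r = Some q ->
    partition [set x : wnode wg_data | wrank x = r] (@wtips_of wg_data)
      (@wtips wg_data q);
  wtips_none : forall x : wnode wg_data, rprev (wrank x) = None -> wtips_of x = set0;
  exceptional_rank : forall x y : wnode wg_data, exceptional x = Some y ->
    rlt (wrank y) (wrank x);
  exceptional_vomega : forall x : wnode wg_data, wrank x = Vomega ->
    exceptional x = None;
  exceptional_inj : forall x x' y : wnode wg_data,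
    exceptional x = Some y -> exceptional x' = Some y -> x = x';
  chain_ofP : forall x : wnode wg_data, wrank x = Vomega ->
    maximal_chain (chain_of x);
  chain_unique : forall c : nat -> wnode wg_data, maximal_chain c ->
    exists! x, wrank x = Vomega /\ chain_of x = c
}.

(** * Wsubgraphs, wconnectedness and wsections *)

Record wsubgraph (G : wgraph) := WSubgraph {
  srank : rank;
  sbranches : set (set (wnode G));
  snodes : set (wnode G)
}.

Definition whole (G : wgraph) : wsubgraph G :=
  WSubgraph (nu G) (@branches G) setT.

Section Subgraphs.
Variable G : wgraph.
Implicit Types (S : wsubgraph G) (x y u v : wnode G) (W : walk (wnode G)).

(* x embraces a tip having a representative whose branches all lie in C; the
   (-1)-tips are the ends of branches, embraced by their 0-nodes. *)
Definition embraces_tip_in (C : set (set (wnode G))) x : Prop :=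
  (exists u b, [/\ embraces x u, C b & b u]) \/
  (exists T W, [/\ embraces_wtip x T, T W & walk_over C setT W]).

(* The wsubgraph, with wnodes of rank at most r, of a set of branches. *)
Definition subgraph_of (r : rank) (C : set (set (wnode G))) : wsubgraph G :=
  WSubgraph r C [set x | rle (wrank x) r /\ embraces_tip_in C x].

Definition walk_in S W : Prop :=
  [/\ is_walk W, rank_le W (srank S) & walk_over (sbranches S) (snodes S) W].

(* A two-ended walk terminating at a wnode is also regarded as terminating at
   any wnode embracing it. *)
Definition terminates_at W x y : Prop :=
  exists u v, [/\ two_ended W u v, embraces x u & embraces y v].

(* No two-ended walk has rank [Vomega], so for wsubgraphs of that rank the
   joining walk has a natural-number rank. *)
Definition swconnected S : Prop :=
  forall x y, snodes S x -> snodes S y ->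
    exists2 W, walk_in S W & terminates_at W x y.

Definition is_wsection (r : rank) S : Prop :=
  (r = nu G /\ S = whole G) \/
  [/\ rlt r (nu G), sbranches S `<=` @branches G,
      S = subgraph_of r (sbranches S), swconnected S &
      forall C, C `<=` @branches G -> sbranches S `<=` C ->
        swconnected (subgraph_of r C) -> C = sbranches S].

Definition lies_in S S' : Prop := sbranches S `<=` sbranches S'.

Definition maximal_in S x : Prop :=
  snodes S x /\ forall y, snodes S y -> embraces y x -> ~~ rlt (wrank x) (wrank y).

Definition wdistance S x y (d : ord) : Prop :=
  exists x' y',
    [/\ maximal_in S x' /\ maximal_in S y', embraces x' x, embraces y' y &
        (x' = y' /\ d = OZero) \/
        (x' <> y' /\
         oleast [set l | exists W, [/\ walk_in S W, terminates_at W x' y' & l = length W]] d)].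

Definition wdistance_le S x y (l : ord) : Prop :=
  exists2 d, wdistance S x y d & ole d l.

End Subgraphs.

Definition wconnected (G : wgraph) : Prop := swconnected (whole G).

(** * Enlargements and galaxies *)

Definition free_ultrafilter (F : set_system nat) : Prop :=
  UltraFilter F /\ \bigcap_(A in F) A = set0.

(* A hypernode is a class of sequences of wnodes; a hyperbranch is a pair of
   0-hypernodes. *)
Definition hyperpoint (V : Type) : Type := set (nat -> V).

Record hypergraph (V : Type) := Hypergraph {
  hypernodes : set (hyperpoint V);
  hyperbranches : set (set (hyperpoint V))
}.

Section Enlargement.
Variables (F : set_system nat) (G : wgraph).
Implicit Types (S : wsubgraph G) (x y : nat -> wnode G) (X Y : hyperpoint (wnode G)).

Definition node_seq S (r : rank) x : Prop :=
  forall n, snodes S (x n) /\ wrank (x n) = r.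

(* The class in the enlargement of S of a sequence of wnodes of rank r. *)
Definition hclass S (r : rank) x : hyperpoint (wnode G) :=
  [set y | node_seq S r y /\ F [set n | x n = y n]].

Definition is_hypernode S (r : rank) X : Prop :=
  exists2 x, node_seq S r x & X = hclass S r x.

Definition is_hyperbranch S (E : set (hyperpoint (wnode G))) : Prop :=
  exists x y,
    [/\ node_seq S (Fin 0) x, node_seq S (Fin 0) y,
        F [set n | sbranches S [set x n; y n]] &
        E = [set hclass S (Fin 0) x; hclass S (Fin 0) y]].

Definition enlargement S : hypergraph (wnode G) :=
  Hypergraph [set X | exists2 r, rle r (srank S) & is_hypernode S r X]
    (is_hyperbranch S).

Definition standard S X : Prop :=
  exists r a, node_seq S r (fun=> a) /\ X = hclass S r (fun=> a).

Definition limit_bound (r : rank) (mu : nat) : ord :=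
  match r with
  | Fin n => opow (onat n) mu
  | Vomega => opow (onat mu) 1
  | Omega => opow omega mu
  end.

Definition limitedly_distant S (r : rank) X Y : Prop :=
  exists x y, [/\ X x, Y y &
    exists mu : nat, F [set n | wdistance_le S (x n) (y n) (limit_bound r mu)]].

(* The galaxy of the enlargement of S whose set of hypernodes is N. *)
Definition galaxy_on S (N : set (hyperpoint (wnode G))) : hypergraph (wnode G) :=
  Hypergraph N [set E | hyperbranches (enlargement S) E /\ E `<=` N].

Definition principal_galaxy S (r : rank) : hypergraph (wnode G) :=
  galaxy_on S
    [set X | hypernodes (enlargement S) X /\
       exists2 Y, standard S Y & limitedly_distant S r X Y].

(* The canonical identification of a hypernode of the enlargement of a wsubgraph
   of S with a hypernode of the enlargement of S: the class of the same sequences,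
   now among all sequences of wnodes of S. *)
Definition hyper_incl S X : hyperpoint (wnode G) :=
  [set y | exists r, node_seq S r y /\ exists2 x, X x & F [set n | x n = y n]].

Definition lies_within S (H H' : hypergraph (wnode G)) : Prop :=
  hyper_incl S @` hypernodes H `<=` hypernodes H' /\
  image (hyperbranches H) (fun E => hyper_incl S @` E) `<=` hyperbranches H'.

End Enlargement.

(* Main.v *)
(** A two-ended walk of finite rank k is a finite chain of pieces of rank at most
    k - 1, so its length is below omega^(k+1); and no two-ended walk has rank
    [Vomega].  Hence two wnodes of [S_alpha], being joined by a walk inside
    [S_alpha], are within one uniform bound omega^mu or omega^rho of each other
    in [S_rho].  So every hypernode [x_n] of the enlargement of [S_alpha] is
    limitedly distant from the standard hypernode of the constant sequence x_0.
    That wdistances exist at all takes two more facts: lengths are in normal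
    form, hence well ordered, and every wnode of a wsection is embraced by a
    maximal one, an infinite ascending chain of finite ranks being capped by the
    [Vomega]-wnode that it is part of. *)

Require Import Defs.
From mathcomp Require Import all_boot all_order all_algebra.
From mathcomp Require Import classical_sets filter.
From mathcomp Require Import boolp zify.
Set Implicit Arguments.
Unset Strict Implicit.
Unset Printing Implicit Defensive.
Import Order.TTheory GRing.Theory Num.Theory.

Local Open Scope classical_set_scope.
Local Open Scope ring_scope.

(** * Ordinals *)

Lemma ocmp_eq a b : ocmp a b = Eq -> a = b.
Proof.
elim: a b => [|e IHe n r IHr] [|e' n' r'] //=.
by case E: ocmp => //; case: ltngtP => // -> /IHr ->; rewrite (IHe _ E).
Qed.

Lemma ocmp_opp a b : ocmp b a = CompOpp (ocmp a b).
Proof.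
elim: a b => [|e IHe n r IHr] [|e' n' r'] //=.
rewrite IHe; case: ocmp => //=; rewrite IHr.
by case: ltngtP.
Qed.

Lemma olt_trans b a c : ocmp a b = Lt -> ocmp b c = Lt -> ocmp a c = Lt.
Proof.
elim: a b c => [|e IHe n r IHr] [|e1 n1 r1] [|e2 n2 r2] //=.
case E: (ocmp e e1) => //; last first.
  by case E1: (ocmp e1 e2) => //; [rewrite -(ocmp_eq E1) E | rewrite (IHe _ _ E E1)].
rewrite (ocmp_eq E); case: (ocmp e1 e2) => //.
case: (ltngtP n n1) => // [h _|->] H.
  case: (ltngtP n1 n2) H => // [h'|<-] _; last by rewrite h.
  by rewrite (ltn_trans h h').
by case: ltngtP H => //= _; apply: IHr.
Qed.

Lemma ole_trans b a c : ole a b -> ole b c -> ole a c.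
Proof.
rewrite /ole; case E: (ocmp a b) => // _; first by rewrite (ocmp_eq E).
case E': (ocmp b c) => // _; first by rewrite -(ocmp_eq E') E.
by rewrite (olt_trans E E').
Qed.

Lemma ole0 a : ole OZero a.
Proof. by case: a. Qed.

(* For [a] in normal form this says a < omega^e. *)
Definition lead_lt (e a : ord) : Prop :=
  if a is OCons e' _ _ then ocmp e' e = Lt else True.

Fixpoint nf (a : ord) : Prop :=
  if a is OCons e _ r then [/\ nf e, nf r & lead_lt e r] else True.

Lemma lead_lt_trans e e' a : lead_lt e a -> ocmp e e' = Lt -> lead_lt e' a.
Proof. by case: a => //= e1 _ _; apply: olt_trans. Qed.

Lemma lead_lt_ole e a : lead_lt e a -> ole a (opow e 1).
Proof. by case: a => //= e1 n r E; rewrite /ole /= E. Qed.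

Lemma oplusE e n r e' n' r' :
  oplus (OCons e n r) (OCons e' n' r') =
  match ocmp e e' with
  | Gt => OCons e n (oplus r (OCons e' n' r'))
  | Lt => OCons e' n' (oplus (OCons e n r) r')
  | Eq => OCons e (n + n').+1 (oplus r r')
  end.
Proof. by []. Qed.

(** The leading exponent of a natural sum is the larger of the two leading exponents, so finite sums
    never climb to omega^e. *)
Lemma lead_lt_oplus e a b :
  lead_lt e a -> lead_lt e b -> lead_lt e (oplus a b).
Proof.
case: a => [|e1 n1 r1]; first by case: b.
by case: b => [|e2 n2 r2] //; rewrite oplusE; case: ocmp.
Qed.

Lemma nf_OCons e n r : nf e -> nf r -> lead_lt e r -> nf (OCons e n r).
Proof. by []. Qed.

Lemma nf_oplus a b : nf a -> nf b -> nf (oplus a b).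
Proof.
elim: a b => [|e _ n r IHr] b; first by case: b.
(* When [b] has the larger leading exponent, [oplus] peels [b] and keeps [a] whole, hence an inner
   induction on [b]. *)
elim: b => [|e' _ n' r' IHr'] // ha hb.
case: (ha) => nfe nfr ler; case: (hb) => nfe' nfr' ler'.
rewrite oplusE; case E: (ocmp e e'); apply: nf_OCons => //.
- exact: IHr.
- by apply: lead_lt_oplus => //; rewrite (ocmp_eq E).
- exact: IHr'.
- exact: lead_lt_oplus.
- exact: IHr.
- by apply: lead_lt_oplus => //=; rewrite ocmp_opp E.
Qed.

Lemma nf_onat n : nf (onat n).
Proof. by case: n. Qed.

Lemma nf_opow e n : nf e -> nf (opow e n).
Proof. by case: n. Qed.

Lemma onat_lt m n : (m < n)%N -> ocmp (onat m) (onat n) = Lt.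
Proof. by case: m n => [|m] [|n] //=; rewrite ltnS => ->. Qed.

Lemma onat_lt_omega n : ocmp (onat n) omega = Lt.
Proof. by case: n. Qed.

(* [ocmp] is not well founded on terms that are not in normal form. *)
Definition nf_lt (a b : ord) : Prop := nf a /\ ocmp a b = Lt.

(** Descent is lexicographic: induction on the leading exponent, then on the coefficient, then on
    the remainder. The remainder is accessible to begin with, since normal form puts its leading
    exponent below [e]. *)
Lemma nf_acc a : nf a -> Acc nf_lt a.
Proof.
have main e : Acc nf_lt e ->
    forall n r, nf (OCons e n r) -> Acc nf_lt (OCons e n r).
  elim=> {}e _ IHe.
  have small c : nf c -> lead_lt e c -> Acc nf_lt c.
    case: c => [_ _|e' n' r' h l]; first by split=> y [_]; case: y.
    by apply: IHe => //; split=> //; case: h.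
  elim/ltn_ind=> n IHn r h.
  have: Acc nf_lt r by case: h => *; apply: small.
  move=> accr; elim: accr h => {}r _ IHr h; split=> -[|e' n' r'] [h' /=].
    by move=> _; apply: small.
  case E: (ocmp e' e); [|by move=> _; exact: (small _ h' E)|by []].
  move: h'; rewrite (ocmp_eq E) => h'.
  case: ltngtP => [lt_n _|_ H|eq_n lt_r]; [exact: IHn | discriminate H |].
  rewrite eq_n in h' *; apply: (IHr _ _ h').
  by split=> //; case: h'.
elim: a => [_|e IHe n r _ h]; first by split=> y [_]; case: y.
by apply: (main _ _ _ _ h); apply: IHe; case: h.
Qed.

Lemma oleast_exists (A : set ord) :
  (forall a, A a -> nf a) -> A !=set0 -> exists d, oleast A d.
Proof.
move=> nfA [a Aa]; have acca := nf_acc (nfA a Aa).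
elim: acca Aa => {}a _ IH Aa.
have [[b [Ab lt_b]]|noless] := pselect (exists b, A b /\ ocmp b a = Lt).
  by apply: (IH b) => //; split=> //; apply: nfA.
exists a; split=> // b Ab le_ba; apply: noless; exists b; split=> //.
by rewrite ocmp_opp le_ba.
Qed.

(** * Lengths *)

Lemma nf_length V (W : walk V) : nf (length W).
Proof.
have nf_tip r n : nf (opow (tip_exponent r) n).
  by apply: nf_opow; case: r => [k| |] //=; apply: nf_onat.
elim: W => [//|r lo hi x P IH].
case: lo hi => [a|] [b|]; [|exact: (nf_tip r 1%N)|exact: (nf_tip r 1%N)|exact: (nf_tip r 2%N)] => /=.
by elim: (iota _ _) => //= i s IHs; apply: nf_oplus.
Qed.

Lemma lead_lt_length V (e : ord) r (a b : int) x (P : int -> walk V) :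
  a <= b ->
  (forall m, in_pieces (Some a) (Some b) m -> lead_lt e (length (P m))) ->
  lead_lt e (length (Walk r (Some a) (Some b) x P)).
Proof.
move=> le_ab hP /=.
(* [length] folds over the offsets from [a]; as [a <= b], each offset below [b - a] names a genuine
   piece. *)
have: {in iota 0 `|b - a|%N, forall i : nat, lead_lt e (length (P (a + i%:Z)))}.
  move=> i; rewrite mem_iota => /andP[_ lt_i]; apply: hP.
  rewrite /in_pieces /in_range; lia.
elim: (iota _ _) => //= i s IHs h; apply: lead_lt_oplus.
  by apply: h; rewrite mem_head.
by apply: IHs => j js; apply: h; rewrite in_cons js orbT.
Qed.

Lemma rank_le_Fin V (W : walk V) k :
  rank_le W (Fin k) -> exists2 j, (j <= k)%N & has_rank W (Fin j).
Proof. by case: W => //= -[j| |] // _ _ _ _ le_jk; exists j. Qed.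

(** The weaker bound covers infinite walks, of length omega^(k+1) or twice that. It is the one
    applied to the pieces: those of a two-ended walk of rank k+1 have rank at most k, hence length
    below omega^(k+2), and so has their finite sum. *)
Lemma length_finite_rank (D : wdata) (W : walk (wnode D)) k :
  is_walk W -> has_rank W (Fin k) ->
  lead_lt (onat k.+2) (length W) /\
  (forall u v, two_ended W u v -> lead_lt (onat k.+1) (length W)).
Proof.
elim: W k => // r lo hi x P IH k /=.
case: lo hi => [a|] [b|] hW rE; try by subst; split=> //=; rewrite ltnSn.
suff: lead_lt (onat k.+1) (length (Walk r (Some a) (Some b) x P)).
  by move=> h; split=> //; apply: (lead_lt_trans h); apply: (@onat_lt k.+1 k.+2).
case: hW => le_ab; rewrite rE; case: k rE => [|k] rE /=.
  case=> _ hP; apply: lead_lt_length => // m /hP[B [-> _ _]] //.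
case=> _ _ hP _; apply: lead_lt_length => // m /hP[wP _ leP _ _].
have [j le_jk rP] := rank_le_Fin leP; have [hl _] := IH m j wP rP.
move: le_jk; rewrite leq_eqVlt => /orP[/eqP <- //|lt_jk].
by apply: (lead_lt_trans hl); apply: (@onat_lt j.+2 k.+2).
Qed.

Lemma two_ended_rank (D : wdata) (W : walk (wnode D)) u v :
  is_walk W -> two_ended W u v -> rank_le W Vomega ->
  exists k, has_rank W (Fin k).
Proof.
case: W => // -[k| |] [a|] [b|] x P //=; first by exists k.
by case=> _ [[]].
Qed.

(** [mu] is chosen from the ranks alone, before any walk, so that one value serves all indices of a
    sequence of wnodes. *)
Lemma length_limit_bound alpha rho : rlt alpha rho ->
  exists mu, forall (D : wdata) (W : walk (wnode D)) u v,
    is_walk W -> rank_le W alpha -> two_ended W u v ->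
    ole (length W) (limit_bound rho mu).
Proof.
move=> lt_ar.
have finite (D : wdata) (W : walk (wnode D)) u v :
    is_walk W -> rank_le W alpha -> two_ended W u v ->
    exists2 k, has_rank W (Fin k) & lead_lt (onat k.+1) (length W).
  move=> wW leW endW.
  have [|k rk] := two_ended_rank wW endW.
    (* Being below [rho], [alpha] is not [Omega], so [W] has rank at most [Vomega]. *)
    by case: W leW {wW endW} => // -[k| |] //=; case: alpha rho lt_ar => [?| |] [?| |].
  by exists k => //; have [_ h] := length_finite_rank wW rk; apply: h endW.
(* For rho = [Vomega] the bound omega^mu must absorb alpha; otherwise a single
   omega^rho is enough. *)
exists (if alpha is Fin n then if rho is Vomega then n.+1 else 1%N else 1%N).
move=> D W u v wW leW endW; have [k rk lk] := finite _ _ _ _ wW leW endW.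
have {leW} leW : rle (Fin k) alpha by case: W rk leW {wW endW lk} => //= ? ? ? ? ? ->.
have bound j : (k < j)%N -> lead_lt (onat j) (length W).
  rewrite leq_eqVlt => /orP[/eqP <- //|lt_kj].
  by apply: lead_lt_trans lk _; apply: onat_lt.
case: rho lt_ar {finite} => [m| |]; case: alpha leW => [n| |] //=.
- rewrite /rlt /= -ltnNge => le_kn lt_nm.
  by apply: lead_lt_ole; apply: bound; apply: leq_ltn_trans lt_nm.
- by move=> le_kn _; apply: (lead_lt_ole (e := onat n.+1)); apply: bound.
- by move=> _ _; apply: lead_lt_ole (lead_lt_trans lk (onat_lt_omega _)).
- by move=> _ _; apply: lead_lt_ole (lead_lt_trans lk (onat_lt_omega _)).
Qed.

(** * Maximal wnodes *)

Lemma rle_trans s r t : rle r s -> rle s t -> rle r t.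
Proof.
by case: r s t => [m| |] [n| |] [p| |] //=; apply: leq_trans.
Qed.

Lemma rlt_le r s : rlt r s -> rle r s.
Proof.
by case: r s => [m| |] [n| |] //=; rewrite /rlt /= -ltnNge => /ltnW.
Qed.

Lemma embraces_trans (D : wdata) (x y z : wnode D) :
  embraces x y -> embraces y z -> embraces x z.
Proof.
elim=> // {}x => [w y' xw _ IH|i y' rx _ IH] yz.
- exact: embraces_exceptional xw (IH yz).
- exact: embraces_chain rx (IH yz).
Qed.

Lemma embraces_rank (G : wgraph) (x y : wnode G) :
  embraces x y -> rle (wrank y) (wrank x).
Proof.
elim=> {x y} => [x|x w y xw _ IH|x i y rx _ IH].
- by case: wrank => /=.
- by apply: rle_trans IH _; apply/rlt_le/exceptional_rank.
- apply: rle_trans IH _; have [h _ _] := chain_ofP rx.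
  by have [n ->] := h i; rewrite rx.
Qed.

Lemma embraces_tip_in_up (G : wgraph) C (x y : wnode G) :
  embraces y x -> embraces_tip_in C x -> embraces_tip_in C y.
Proof.
move=> yx [[u [b [xu Cb bu]]]|[T [W [[u xu uT] TW CW]]]].
  by left; exists u, b; split=> //; apply: embraces_trans xu.
right; exists T, W; split=> //.
by exists u => //; apply: embraces_trans xu.
Qed.

(** Prepending the exceptional element of [c 0] strictly lowers a natural-number rank, so this
    stops. Only maximal chains are known to be [Vomega]-wnodes, which is why the extension is
    made. *)
Lemma extend_chain_down (G : wgraph) (c : nat -> wnode G) :
  (forall i, exists n, wrank (c i) = Fin n) ->
  (forall i, exceptional (c i.+1) = Some (c i)) ->
  exists2 c', maximal_chain c' & exists j, c' j = c 0%N.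
Proof.
move=> fin step; have [n rn] := fin 0%N.
elim/ltn_ind: n c fin step rn => n IH c fin step rn.
case E: (exceptional (c 0%N)) => [y|]; last by exists c; [split | exists 0%N].
have := exceptional_rank E; rewrite rn.
case ry: (wrank y) => [m| |] //; rewrite /rlt /= -ltnNge => lt_mn.
pose c1 i := if i is i'.+1 then c i' else y.
have [||//|c' maxc' [j c'j]] := IH m lt_mn c1; last 1 first.
- have [_ step' c'0] := maxc'.
  exists c' => //; exists j.+1.
  (* Both [c' j.+1] and [c 0] have [y] as exceptional element, hence coincide. *)
  by apply: (@exceptional_inj G _ _ y); rewrite ?step' ?c'j.
- by case=> [|i] /=; [exists m | apply: fin].
- by case.
Qed.

Lemma upward_chain_vomega (G : wgraph) (c : nat -> wnode G) :
  (forall i, exists n, wrank (c i) = Fin n) ->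
  (forall i, exceptional (c i.+1) = Some (c i)) ->
  exists2 v, wrank v = Vomega & embraces v (c 0%N).
Proof.
move=> fin step; have [c' maxc' [j <-]] := extend_chain_down fin step.
have [v [[rv vc'] _]] := chain_unique maxc'.
exists v => //; apply: (embraces_chain (i := j)) => //.
by rewrite vc'; apply: embraces_refl.
Qed.

(** This rules out infinite ascending chains in a wsection of finite rank. *)
Lemma chain_rank_unbounded (G : wgraph) (c : nat -> wnode G) k :
  (forall i, exceptional (c i.+1) = Some (c i)) ->
  rle (Fin k) (wrank (c k)).
Proof.
move=> step; elim: k => [|k]; first by case: wrank.
have := exceptional_rank (step k); rewrite /rlt.
case: wrank => [m| |]; case: wrank => [n| |] //=.
by rewrite -ltnNge => lt_mn le_km; apply: leq_ltn_trans lt_mn.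
Qed.

(** Membership means embracing a tip represented in the branches, and [y] embraces every tip that
    [x] does. *)
Lemma wsection_up (G : wgraph) r (S : wsubgraph G) x y :
  is_wsection r S -> snodes S x -> embraces y x -> rle (wrank y) r ->
  snodes S y.
Proof.
move=> [[_ ->] //|[_ _ -> _ _]] [_ tip] yx le_yr; split=> //=.
exact: embraces_tip_in_up tip.
Qed.

Lemma wsection_rank (G : wgraph) r (S : wsubgraph G) x :
  is_wsection r S -> snodes S x -> rle (wrank x) r.
Proof.
by move=> [[-> ->] _|[_ _ -> _ _] []//]; apply: wrank_le.
Qed.

(** Below a wnode of finite rank, embracing passes through exceptional elements only; the last link
    before [x] is the parent. Higher wnodes thus yield single steps that can be iterated into a
    chain. *)
Lemma embraces_parent (G : wgraph) (x z : wnode G) n :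
  embraces z x -> wrank z = Fin n -> z <> x ->
  exists2 p, exceptional p = Some x & embraces z p.
Proof.
move=> zx; elim: zx n => {z x} [//|z w x zw wx IH|z i x rz _ _] n rn ne;
  last by rewrite rn in rz.
have [eq_wx|ne_wx] := pselect (w = x).
  by exists z; [rewrite -eq_wx | apply: embraces_refl].
have := exceptional_rank zw; rewrite rn.
case rw: (wrank w) => [m| |] // _; have [p px wp] := IH m rw ne_wx.
by exists p => //; apply: embraces_exceptional zw wp.
Qed.

Lemma exists_maximal_in (G : wgraph) r (S : wsubgraph G) x :
  is_wsection r S -> snodes S x ->
  exists2 x', maximal_in S x' & embraces x' x.
Proof.
move=> secS Sx; apply: contrapT => nomax.
pose A y := snodes S y /\ embraces y x.
have higher y : A y -> exists z, [/\ A z, embraces z y & rlt (wrank y) (wrank z)].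
  move=> [Sy yx]; apply: contrapT => noz; apply: nomax.
  exists y => //; split=> // z Sz zy; apply/negP => lt_yz; apply: noz.
  by exists z; split=> //; split=> //; apply: embraces_trans yx.
(* Nothing lies above an [Omega]-wnode, and above a [Vomega]-wnode only an [Omega]-wnode could lie,
   which would again need one above it. *)
have finA y : A y -> exists n, wrank y = Fin n.
  move=> Ay; case ry: (wrank y) => [n| |]; first by exists n.
  - have [z [Az _]] := higher y Ay; rewrite ry.
    case rz: (wrank z) => [//|//|] _.
    have [w [_ _]] := higher z Az; rewrite rz.
    by case: (wrank w).
  - by have [z [_ _]] := higher y Ay; rewrite ry; case: (wrank z).
(* Without a maximal wnode above x, parents can be taken forever inside A. *)
have parent (y : {y | A y}) : {z : {z | A z} | exceptional (sval z) = Some (sval y)}.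
  apply: cid; case: y => y Ay /=; have [z [Az zy lt_yz]] := higher y Ay.
  have [n rn] := finA z Az.
  have [|p py zp] := embraces_parent zy rn.
    by move=> zy'; move: lt_yz; rewrite zy' /rlt; case: wrank => //= k; rewrite leqnn.
  have py' : embraces p y by apply: embraces_exceptional py (embraces_refl _).
  have Ap : A p.
    split; last by apply: embraces_trans py' _; case: Ay.
    case: Ay => Sy _; apply: (wsection_up secS Sy py').
    apply: rle_trans (embraces_rank zp) _.
    by case: Az => Sz _; exact: (wsection_rank secS Sz).
  by exists (exist _ p Ap).
have Ax : A x by split=> //; apply: embraces_refl.
pose c i := iter i (fun y => sval (parent y)) (exist A x Ax).
have step i : exceptional (sval (c i.+1)) = Some (sval (c i)).
  exact: svalP (parent (c i)).
have [v rv vx] := upward_chain_vomega (fun i => finA _ (svalP (c i))) step.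
suff Av : A v by have [n] := finA v Av; rewrite rv.
split=> //; apply: (wsection_up secS Sx vx); rewrite rv.
(* It remains that [r] is not finite: for [r = Fin n] the member [c n.+1] of the chain would have
   rank above [n]. *)
case: r secS => // n secS.
have le_n : rle (wrank (sval (c n.+1))) (Fin n).
  by case: (svalP (c n.+1)) => Sc _; exact: (wsection_rank secS Sc).
have := rle_trans (chain_rank_unbounded n.+1 step) le_n.
by rewrite /= ltnn.
Qed.

(** * Wsections and enlargements *)

Lemma walk_over_sub V (C C' : set (set V)) (N N' : set V) (W : walk V) :
  C `<=` C' -> N `<=` N' -> walk_over C N W -> walk_over C' N' W.
Proof.
move=> CC' NN'; elim: W => [b|r lo hi x P IH] /=; first exact: CC'.
by move=> [hx hP]; split=> m hm; [apply/NN'/hx | apply/IH/hP].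
Qed.

Lemma wsection_proper (G : wgraph) r s (S : wsubgraph G) :
  rlt r s -> rle s (nu G) -> is_wsection r S ->
  S = subgraph_of r (sbranches S) /\ swconnected S.
Proof.
move=> lt_rs le_s [[r_nu _]|[_ _ SE conS _]] //.
by move: lt_rs; rewrite /rlt r_nu le_s.
Qed.

Lemma wsection_srank (G : wgraph) r (S : wsubgraph G) :
  is_wsection r S -> srank S = r.
Proof. by move=> [[-> ->]|[_ _ -> _ _]]. Qed.

Lemma wsection_nodes_sub (G : wgraph) r s (S S' : wsubgraph G) :
  rlt r s -> rle s (nu G) -> is_wsection r S -> is_wsection s S' ->
  lies_in S S' -> snodes S `<=` snodes S'.
Proof.
move=> lt_rs le_s secS secS' SS' x.
have [-> _] := wsection_proper lt_rs le_s secS.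
case: secS' SS' => [[_ ->] //|[_ _ -> _ _]] SS' [le_x tip] /=.
split; first by apply: rle_trans le_x (rlt_le lt_rs).
case: tip => [[u [b [xu Cb bu]]]|[T [W [xT TW CW]]]].
  by left; exists u, b; split=> //; apply: SS'.
by right; exists T, W; split=> //; apply: walk_over_sub CW.
Qed.

Lemma walk_in_sub (G : wgraph) r s (S S' : wsubgraph G) W :
  rlt r s -> rle s (nu G) -> is_wsection r S -> is_wsection s S' ->
  lies_in S S' -> walk_in S W -> walk_in S' W.
Proof.
move=> lt_rs le_s secS secS' SS' [wW leW overW]; split=> //.
  rewrite (wsection_srank secS'); rewrite (wsection_srank secS) in leW.
  case: W leW {wW overW} => //= q _ _ _ _ le_qr.
  exact: rle_trans le_qr (rlt_le lt_rs).
apply: walk_over_sub overW => //.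
exact: wsection_nodes_sub secS secS' SS'.
Qed.

(** A walk joining [x] and [y] inside [Sa] is also a walk of [Sr], and it counts as terminating at
    the maximal wnodes embracing them; the minimum defining the wdistance is at most its length. *)
Lemma wsection_wdistance_le (G : wgraph) alpha rho (Sa Sr : wsubgraph G) :
  rlt alpha rho -> rle rho (nu G) ->
  is_wsection alpha Sa -> is_wsection rho Sr -> lies_in Sa Sr ->
  exists mu, forall x y, snodes Sa x -> snodes Sa y ->
    wdistance_le Sr x y (limit_bound rho mu).
Proof.
move=> lt_ar le_r secA secR AR.
have [mu bound] := length_limit_bound lt_ar; exists mu => x y Ax Ay.
have AsubR := wsection_nodes_sub lt_ar le_r secA secR AR.
have [x' maxx x'x] := exists_maximal_in secR (AsubR _ Ax).
have [y' maxy y'y] := exists_maximal_in secR (AsubR _ Ay).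
have [eq_xy|ne_xy] := pselect (x' = y').
  exists OZero; last exact: ole0.
  by exists x', y'; split=> //; left.
have [_ conA] := wsection_proper lt_ar le_r secA.
have [W inW [u [v [endW xu yv]]]] := conA x y Ax Ay.
pose L := [set l | exists W, [/\ walk_in Sr W, terminates_at W x' y' & l = length W]].
have LW : L (length W).
  exists W; split; [exact: (walk_in_sub lt_ar le_r secA secR AR inW)| |by []].
  by exists u, v; split; [|exact: (embraces_trans x'x)|exact: (embraces_trans y'y)].
have [|d dmin] := @oleast_exists L _ (ex_intro _ _ LW).
  by move=> _ [w [_ _ ->]]; apply: nf_length.
exists d; first by exists x', y'; split=> //; right.
apply: ole_trans (dmin.2 _ LW) _.
by case: inW => wW leW _; apply: bound endW => //; rewrite -(wsection_srank secA).
Qed.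

(** * Transfer of hypernodes to the larger wsection *)

Lemma hclass_refl F (G : wgraph) (S : wsubgraph G) r x :
  Filter F -> node_seq S r x -> hclass F S r x x.
Proof.
move=> FF Sx; split=> //.
by apply: filterS filterT => n _.
Qed.

Lemma hyper_incl_hclass F (G : wgraph) (S S' : wsubgraph G) r x :
  ProperFilter F -> snodes S `<=` snodes S' -> node_seq S r x ->
  hyper_incl F S' (hclass F S r x) = hclass F S' r x.
Proof.
move=> FF SS' Sx; apply/seteqP; split=> y /=.
  move=> [r' [S'y [x' [_ xx'] x'y]]].
  have xy : F [set n | x n = y n].
    by apply: filterS2 xx' x'y => n /= -> ->.
  split=> //; suff <- : r' = r by [].
  (* Sets of a proper filter are nonempty, and agreement at a single index already forces the ranks
     to be equal. *)
  have [n /= xyn] := filter_ex xy.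
  by rewrite -(S'y n).2 -xyn (Sx n).2.
move=> [S'y xy]; exists r; split=> //; exists x => //.
exact: hclass_refl.
Qed.

Theorem theorem3p2 (F : set_system nat) (hF : free_ultrafilter F)
    (G : wgraph) (hG : wconnected G)
    (alpha rho : rank) (h_alpha_rho : rlt alpha rho) (h_rho_nu : rle rho (nu G))
    (S_rho : wsubgraph G) (h_S_rho : is_wsection rho S_rho)
    (S_alpha : wsubgraph G) (h_S_alpha : is_wsection alpha S_alpha)
    (h_lies : lies_in S_alpha S_rho) :
  lies_within F S_rho (enlargement F S_alpha)
    (principal_galaxy F S_rho rho).
Proof.
have FF : ProperFilter F by case: hF => -[].
have sub := wsection_nodes_sub h_alpha_rho h_rho_nu h_S_alpha h_S_rho h_lies.
have inclE r x : node_seq S_alpha r x ->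
    hyper_incl F S_rho (hclass F S_alpha r x) = hclass F S_rho r x.
  exact: hyper_incl_hclass.
have sub_seq r x : node_seq S_alpha r x -> node_seq S_rho r x.
  by move=> h n; have [/sub] := h n.
have [mu dist] :=
  wsection_wdistance_le h_alpha_rho h_rho_nu h_S_alpha h_S_rho h_lies.
have nodes r x : node_seq S_alpha r x ->
    hypernodes (principal_galaxy F S_rho rho) (hclass F S_rho r x).
  move=> Ax; have Rx := sub_seq _ _ Ax; have [Ax0 rx0] := Ax 0%N; split.
    exists r; last by exists x.
    rewrite (wsection_srank h_S_rho) -rx0.
    exact: wsection_rank h_S_rho (sub _ Ax0).
  have Ra : node_seq S_rho r (fun=> x 0%N) by move=> n; apply: Rx.
  exists (hclass F S_rho r (fun=> x 0%N)); first by exists r, (x 0%N).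
  exists x, (fun=> x 0%N); split; try exact: hclass_refl.
  (* The bound is uniform over the wnodes of [S_alpha], so it holds at every index. *)
  exists mu; apply: filterS filterT => n _ /=.
  by apply: dist => //; have [] := Ax n.
split=> [_ [X [r _ [x Ax ->]] <-]|_ [_ [x [y [Ax Ay Fxy ->]]] <-]].
  by rewrite inclE //; apply: nodes.
have -> : hyper_incl F S_rho @` [set hclass F S_alpha (Fin 0) x; hclass F S_alpha (Fin 0) y]
    = [set hclass F S_rho (Fin 0) x; hclass F S_rho (Fin 0) y].
  by rewrite image_setU !image_set1 !inclE.
(* A hyperbranch belongs to the galaxy once both of its hypernodes do; that it is one of the
   enlargement of [S_rho] follows from the inclusion of branches. *)
split; last by move=> _ [->|->]; apply: nodes.
exists x, y; split=> //; try exact: sub_seq.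
by apply: filterS Fxy => n; apply: h_lies.
Qed.
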